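(* **(Completeness.)** Let $n\in\mathbb N$, $\epsilon^c_{\mathrm{PE}}\in(0,1)$, and let $f^{\mathrm{PE}}(p)=\sum_{x=0}^3\sum_{z=0}^{m-1}h_{x,z,\perp}p(x,z,\perp)$ with real coefficients. Order the triples $(x,z,\perp)$ lexicographically as $i=1,\dots,4m$ (i.e. $(0,0,\perp)\to1,\dots,(0,m-1,\perp)\to m,(1,0,\perp)\to m+1,\dots,(3,m-1,\perp)\to4m$) and put $\pi_i=p_0(x,z,\perp)$, $h_i=h_{x,z,\perp}$ for $i\le4m$, $\pi_{4m+1}=1-\sum_{i=1}^{4m}\pi_i$, $h_{4m+1}=0$. For $i=1,\dots,4m$ let $$\gamma_i=\frac{\pi_i\big(1-\sum_{j=1}^i\pi_j\big)}{1-\sum_{j=1}^{i-1}\pi_j},\qquad c_i=h_i-\frac{\sum_{j=i+1}^{4m+1}h_j\pi_j}{1-\sum_{j=1}^i\pi_j},\qquad D=\max_{i,j\in\{1,\dots,4m+1\}}|h_i-h_j|.$$ Let $\Omega_{\mathrm{PE}}$ be the event $f^{\mathrm{PE}}(\mathrm{freq}_{c_1^n})\ge f^{\mathrm{PE}}(p_0)-\delta^{\mathrm{tol}}_{\mathrm{PE}}$ with $$\delta^{\mathrm{tol}}_{\mathrm{PE}}=2\sqrt{\log\Big(\frac{n}{\epsilon^c_{\mathrm{PE}}}\Big)\sum_{i=1}^{4m}\frac{\gamma_ic_i^2}{n}}+\frac{3D}{n}\log\frac{n}{\epsilon^c_{\mathrm{PE}}}.$$ Let $\epsilon^c_{\mathrm{EC}}\in(0,1)$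 be a completeness parameter of the error-correction protocol, i.e. $1-\Pr_{\mathrm{hon}}[\Omega_{\mathrm{EC}}]\le\epsilon^c_{\mathrm{EC}}$. Then the physical QKD protocol is $(\epsilon^c_{\mathrm{PE}}+\epsilon^c_{\mathrm{EC}})$-complete, i.e. $\Pr_{\mathrm{hon}}[\Omega^{\mathrm{phys}}_{\mathrm{NA}}]\ge1-\epsilon^c_{\mathrm{PE}}-\epsilon^c_{\mathrm{EC}}$, where $\Omega^{\mathrm{phys}}_{\mathrm{NA}}=\Omega_{\mathrm{PE}}\cap\Omega_{\mathrm{EC}}$.
   Context: $\log$ is base 2. **Physical protocol.** Fix $\alpha\in\mathbb R$ and coherent states with amplitudes $\varphi_x=\alpha,i\alpha,-\alpha,-i\alpha$ for $x=0,1,2,3$. Alice prepares $n$ copies of $|\psi\rangle_{AA'}=\frac12\sum_{x=0}^3|x\rangle_A|\varphi_x\rangle_{A'}$ and sends the $A'$ systems to Bob. In each round $i$, independently, $R_i\in\{0,1,2\}$ is drawn with probabilities $p^{\mathrm{key}},p^{\mathrm{PE}},p^{\mathrm{tom}}$ (summing to 1). If $R_i=0$ (key round), Alice measures $A_i$ in the basis $\{|x\rangle\}$, giving $\hat X_i$, and Bob does heterodyne detection and records in $\hat Z_i\in\{0,1,2,3\}$ the phase quadrant $[\frac\pi4(2j-1),\frac\pi4(2j+1))$ of his outcome. If $R_i=1$ (parameter estimation), Alice measures $A_i$ in the basis $\{|x\rangle\}$, giving $\tilde X_i\in\{0,\dots,3\}$, and Bob discretises his heterodyne outcome $y=|y|e^{i\theta}$: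 with fixed $\Delta,\delta>0$, $\Delta/\delta\in\mathbb N$, $m=4\Delta/\delta+4$, if $\theta\in[\frac\pi4(2j-1),\frac\pi4(2j+1))$ then $\tilde Z_i=j+4k$ when $|y|\in[\delta k,\delta(k+1))$ for $0\le k\le\Delta/\delta-1$, and $\tilde Z_i=j+4\Delta/\delta$ when $|y|\ge\Delta$. If $R_i=2$ the round is discarded. Variables not assigned in a round equal $\perp$. For each string $c_1^n$ of round statistics (with $c_i=(x,z,\perp)$ meaning that round $i$ is a parameter-estimation round with $\tilde X_i=x,\tilde Z_i=z$), $\mathrm{freq}_{c_1^n}(c)=|\{i:c_i=c\}|/n$. The protocol aborts after parameter estimation unless $\Omega_{\mathrm{PE}}$ holds, and after error correction unless $\Omega_{\mathrm{EC}}$ holds, where $\Omega_{\mathrm{EC}}$ is the event that a random hash of Bob's raw key $\hat Z_1^n$ equals the same hash of Alice's error-corrected guess $\bar X_1^n$. **Honest implementation.** The channel consists of $n$ iid uses of a phase-invariant Gaussian channel with transmittance $\eta$ and excess noise $\xi$, with no attack by Eve; $\Pr_{\mathrm{hon}}$ is probability in this implementation. In it, each round independently has probability $p_0(x,z,\perp)=p^{\mathrm{PE}}p_0^{\mathrm{sim}}(x,z)$ of being a parameter-estimation round with $(\tilde X_i,\tilde Z_i)=(x,z)$, where $$p_0^{\mathrm{sim}}(x,z)=\int_{\tilde{\mathcal R}_z}\frac{\gamma\exp\!\Big(\frac{-|\gamma e^{i\theta}-\sqrt\eta\,\varphi_x|^2}{1+\eta\xi/2}\Big)}{4\pi(1+\eta\xi/2)}\,d\theta\,d\gamma$$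 and $\tilde{\mathcal R}_z$ is the region of polar coordinates $(\gamma,\theta)$ on which Bob outputs $\tilde Z=z$. A protocol is $\epsilon^{\mathrm{com}}$-complete if $1-\Pr_{\mathrm{hon}}[\text{no abort}]\le\epsilon^{\mathrm{com}}$. *)

(* Defs.v *)
From HB Require Import structures.
From mathcomp Require Import all_boot all_order all_algebra.
From mathcomp Require Import all_classical all_reals all_analysis.
From mathcomp Require Import complex.

Set Implicit Arguments.
Unset Strict Implicit.
Unset Printing Implicit Defensive.

Import Order.TTheory GRing.Theory Num.Theory.
Import numFieldNormedType.Exports.
Local Open Scope classical_set_scope.
Local Open Scope ring_scope.

Definition log2 (R : realType) (x : R) : R := ln x / ln 2.

(* The quotient Delta / delta is carried as the natural number [levels]. *)
Record protocol (R : realType) := Protocol {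
  alpha : R;
  p_key : R;
  p_PE : R;
  p_tom : R;
  Delta : R;
  delta : R;
  levels : nat;
  p_key_ge0 : 0 <= p_key;
  p_PE_ge0 : 0 <= p_PE;
  p_tom_ge0 : 0 <= p_tom;
  p_sum1 : p_key + p_PE + p_tom = 1;
  Delta_gt0 : 0 < Delta;
  delta_gt0 : 0 < delta;
  levelsE : Delta / delta = levels%:R
}.

Section Protocol.
Variables (R : realType) (Q : protocol R).

Definition amplitude (x : nat) : R[i] := (alpha Q)%:C%C * (0 +i* 1)%C ^+ x.

Definition expi (theta : R) : R[i] := (cos theta +i* sin theta)%C.

Definition key_round : 'I_3 := inord 0.
Definition PE_round : 'I_3 := inord 1.
Definition tom_round : 'I_3 := inord 2.

Definition p_round (r : 'I_3) : R := nth 0 [:: p_key Q; p_PE Q; p_tom Q] r.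

(* m = 4 Delta / delta + 4, written as a successor so that [inord] applies *)
Definition nbins : nat := (4 * levels Q).+4.

(* Heterodyne outcomes y = |y| e^(i theta) are pairs (|y|, theta) of polar
   coordinates, with theta normalised to [-pi/4, 7pi/4). *)
Definition in_quadrant (j : nat) (theta : R) : Prop :=
  pi / 4 * (2 * j%:R - 1) <= theta < pi / 4 * (2 * j%:R + 1).

Definition polar_domain : set (R * R) :=
  [set u | 0 <= u.1 /\ - (pi / 4) <= u.2 < 7 * pi / 4].

(* z = j + 4 k, where k = Delta / delta is the unbounded ring |y| >= Delta *)
Definition PE_region (z : nat) : set (R * R) :=
  [set u | in_quadrant (z %% 4) u.2 /\
           if (z %/ 4 < levels Q)%N
           then delta Q * (z %/ 4)%:R <= u.1 < delta Q * (z %/ 4).+1%:R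
           else Delta Q <= u.1].

Section Channel.
Variables (eta xi : R).

(* Joint density of Alice's symbol x (uniform, whence 4 pi instead of pi) and
   Bob's heterodyne outcome in polar coordinates. *)
Definition heterodyne_density (x : nat) (u : R * R) : R :=
  u.1 * expR (- (ComplexField.Normc.normc
                   ((u.1)%:C * expi u.2 - (Num.sqrt eta)%:C * amplitude x)%C) ^+ 2
              / (1 + eta * xi / 2))
  / (4 * pi * (1 + eta * xi / 2)).

Definition leb2 := (@lebesgue_measure R \x @lebesgue_measure R)%E.

Definition p0_sim (x z : nat) : R :=
  \int[leb2]_(u in PE_region z) heterodyne_density x u.

Definition p0 (x : 'I_4) (z : 'I_nbins) : R := p_PE Q * p0_sim x z.

End Channel.

Section Run.
Variables (n : nat) (d : measure_display) (Omega : measurableType d).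
Variables (K T : finType).

Definition raw_key := n.-tuple (option 'I_4).

(* The random variables of a run.  [symbol i] is the outcome of Alice's
   measurement of A_i in the basis |x>, and ([radius i], [phase i]) is Bob's
   heterodyne outcome; their values in discarded rounds play no role, and only
   their law in the other rounds is prescribed below.  The error-correction subprotocol is only seen through Alice's
   resulting guess of Bob's raw key; [seed] selects the random hash. *)
Record run := Run {
  round : 'I_n -> Omega -> 'I_3;
  symbol : 'I_n -> Omega -> 'I_4;
  radius : 'I_n -> Omega -> R;
  phase : 'I_n -> Omega -> R;
  guess : Omega -> raw_key;
  seed : Omega -> K;
  measurable_round : forall i r, measurable (round i @^-1` [set r]);
  measurable_symbol : forall i x, measurable (symbol i @^-1` [set x]);
  measurable_radius : forall i, measurable_fun setT (radius i);
  measurable_phase : forall i, measurable_fun setT (phase i);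
  measurable_guess : forall s, measurable (guess @^-1` [set s]);
  measurable_seed : forall k, measurable (seed @^-1` [set k]);
  polar_outcome : forall i w, polar_domain (radius i w, phase i w)
}.

Variable X : run.

(* In all the following, [None] is the symbol "bottom". *)
Definition X_key (i : 'I_n) (w : Omega) : option 'I_4 :=
  if round X i w == key_round then Some (symbol X i w) else None.

Definition Z_key (i : 'I_n) (w : Omega) : option 'I_4 :=
  if round X i w == key_round
  then [pick j : 'I_4 | `[< in_quadrant j (phase X i w) >]] else None.

Definition X_PE (i : 'I_n) (w : Omega) : option 'I_4 :=
  if round X i w == PE_round then Some (symbol X i w) else None.

Definition Z_PE (i : 'I_n) (w : Omega) : option 'I_nbins :=
  if round X i w == PE_round
  then [pick z : 'I_nbins | `[< PE_region z (radius X i w, phase X i w) >]]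
  else None.

(* The third entry of a statistics triple (x, z, bottom) is always bottom and
   is omitted. *)
Definition statistics : Type := option 'I_4 * option 'I_nbins.

Definition stat (i : 'I_n) (w : Omega) : statistics := (X_PE i w, Z_PE i w).

Definition freq (c : 'I_n -> statistics) (x : 'I_4) (z : 'I_nbins) : R :=
  #|[pred i | c i == (Some x, Some z)]|%:R / n%:R.

Definition f_PE (h p : 'I_4 -> 'I_nbins -> R) : R :=
  \sum_(x < 4) \sum_(z < nbins) h x z * p x z.

Definition Omega_PE (eta xi tol : R) (h : 'I_4 -> 'I_nbins -> R) : set Omega :=
  [set w | f_PE h (p0 eta xi) - tol <= f_PE h (freq (fun i => stat i w))].

Definition Omega_EC (hash : K -> raw_key -> T) : set Omega :=
  [set w | hash (seed X w) [tuple Z_key i w | i < n] =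
           hash (seed X w) (guess X w)].

Definition Omega_NA (eta xi tol : R) (h : 'I_4 -> 'I_nbins -> R)
    (hash : K -> raw_key -> T) : set Omega :=
  Omega_PE eta xi tol h `&` Omega_EC hash.

Definition round_event (i : 'I_n) (E : 'I_3 -> 'I_4 -> set (R * R)) :
    set Omega :=
  [set w | E (round X i w) (symbol X i w) (radius X i w, phase X i w)].

(* As [E i] may be everything, the product rule over all rounds includes the one
   over each subset of the rounds. *)
Definition rounds_independent (P : probability Omega R) : Prop :=
  forall E : 'I_n -> 'I_3 -> 'I_4 -> set (R * R),
    (forall i r x, measurable (E i r x)) ->
    P [set w | forall i, round_event i (E i) w] =
    (\prod_(i < n) P (round_event i (E i)))%E.

(* Honest implementation: n iid uses of the phase-invariant Gaussian channel
   of transmittance eta and excess noise xi. *)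
Record honest (eta xi : R) (P : probability Omega R) : Prop := Honest {
  honest_eta : 0 <= eta <= 1;
  honest_xi : 0 <= xi;
  honest_round : forall i r, P (round X i @^-1` [set r]) = (p_round r)%:E;
  honest_outcome : forall i r x (B : set (R * R)), r != tom_round ->
    measurable B ->
    P [set w | [/\ round X i w = r, symbol X i w = x &
                   B (radius X i w, phase X i w)]] =
    ((p_round r)%:E *
       \int[leb2]_(u in B `&` polar_domain)
          (heterodyne_density eta xi x u)%:E)%E;
  honest_independent : rounds_independent P
}.

(* [NA] is the event that the protocol does not abort. *)
Definition complete (P : probability Omega R) (NA : set Omega) (eps : R) :
  Prop := (1 - P NA <= eps%:E)%E.

End Run.

Section Tolerance.
Variables (eta xi : R) (h : 'I_4 -> 'I_nbins -> R).

(* Sequences below are indexed from 1; i = x m + z + 1 is the lexicographic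
   position of (x, z). *)
Definition lex (F : 'I_4 -> 'I_nbins -> R) (i : nat) : R :=
  F (inord (i.-1 %/ nbins)) (inord (i.-1 %% nbins)).

Definition pi_seq (i : nat) : R :=
  if (i <= 4 * nbins)%N then lex (p0 eta xi) i
  else 1 - \sum_(1 <= j < (4 * nbins).+1) lex (p0 eta xi) j.

Definition h_seq (i : nat) : R := if (i <= 4 * nbins)%N then lex h i else 0.

Definition gamma_seq (i : nat) : R :=
  pi_seq i * (1 - \sum_(1 <= j < i.+1) pi_seq j)
  / (1 - \sum_(1 <= j < i) pi_seq j).

(* If p_PE = 1 the denominator vanishes at i = 4 m, where x / 0 = 0 applies; the
   value is then irrelevant, as gamma_i = 0. *)
Definition c_seq (i : nat) : R :=
  h_seq i - (\sum_(i.+1 <= j < (4 * nbins).+2) h_seq j * pi_seq j)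
            / (1 - \sum_(1 <= j < i.+1) pi_seq j).

Definition D_h : R :=
  \big[Num.max/0]_(1 <= i < (4 * nbins).+2)
    \big[Num.max/0]_(1 <= j < (4 * nbins).+2) `|h_seq i - h_seq j|.

Definition delta_tol (n : nat) (eps : R) : R :=
  2 * Num.sqrt (log2 (n%:R / eps) *
                \sum_(1 <= i < (4 * nbins).+1)
                   gamma_seq i * c_seq i ^+ 2 / n%:R)
  + 3 * D_h / n%:R * log2 (n%:R / eps).

End Tolerance.
End Protocol.

(* Main.v *)
(* By the law of total variance, applied after revealing whether a round has
   statistic 1, then 2, and so on, sum_i gamma_i c_i^2 is the variance of h under
   the single-round law p_0.  The score of n honest rounds is thus a sum of iid
   variables of this variance, each deviating from its mean by at most D, and
   Bernstein's inequality bounds the probability that it falls short by the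
   tolerance by exp(- log2 (n / eps)) <= eps.  As a run has finitely many strings
   of statistics, the Chernoff argument is a finite sum over these strings.  The
   union bound accounts for the failure of error correction. *)
Require Import Defs.
From HB Require Import structures.
From mathcomp Require Import all_boot all_order all_algebra.
From mathcomp Require Import all_classical all_reals all_analysis.
From mathcomp Require Import ring lra.
Import Order.TTheory GRing.Theory Num.Theory.
Local Open Scope ring_scope.

Set Implicit Arguments.
Unset Strict Implicit.

(** * Variance decomposition and Bernstein's inequality *)

(** With [y = x / 2], the bound [1 - y <= expR (- y)] gives [expR x <= (1 - y) ^- 2], which leaves a
    polynomial inequality valid for [y <= 1 / 6]. Since [x] is bounded only from above, a one-sided
    bound on deviations will suffice. *)
Lemma expR_le_quadratic (R : realType) (x : R) :
  x <= 1 / 3 -> expR x <= 1 + x + x ^+ 2.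
Proof.
move=> x3.
have -> : x = x / 2 + x / 2 by lra.
rewrite expRD; set y := x / 2.
have y1 : 0 < 1 - y by rewrite /y; lra.
have ey : expR y <= (1 - y)^-1.
  rewrite -[expR y]invrK lef_pV2 ?posrE ?invr_gt0 ?expR_gt0// -expRN.
  by have := expR_ge1Dx (- y).
apply: (@le_trans _ _ ((1 - y)^-1 ^+ 2)).
  by rewrite expr2 ler_pM ?expR_ge0.
rewrite exprVn -div1r ler_pdivrMr ?exprn_gt0//.
have : 0 <= y ^+ 2 * (1 - 6 * y + 4 * y ^+ 2).
  rewrite mulr_ge0 ?sqr_ge0//.
  (* For [y <= 1 / 6] the base is at least [7 / 6], and [49 / 36] exceeds [5 / 4]. *)
  have -> : 1 - 6 * y + 4 * y ^+ 2 = (3 / 2 - 2 * y) ^+ 2 - 5 / 4 by field.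
  rewrite subr_ge0 (@le_trans _ _ ((7 / 6) ^+ 2))//; first by lra.
  by rewrite lerXn2r ?nnegrE//; rewrite /y; lra.
suff -> : (1 + (y + y) + (y + y) ^+ 2) * (1 - y) ^+ 2 =
          1 + y ^+ 2 * (1 - 6 * y + 4 * y ^+ 2) by rewrite lerDl.
by ring.
Qed.

(** Among the outcomes from [i] on, revealing whether the outcome is [i] lowers the mass-weighted
    second central moment by exactly the [i]-th summand, so the sum telescopes to the full
    variance. *)
Lemma sum_gamma_c_variance (R : realFieldType) (N : nat) (p h : nat -> R) :
  (forall j, 0 <= p j) -> \sum_(1 <= j < N.+2) p j = 1 ->
  \sum_(1 <= i < N.+1)
    p i * (1 - \sum_(1 <= j < i.+1) p j) / (1 - \sum_(1 <= j < i) p j)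
    * (h i - (\sum_(i.+1 <= j < N.+2) h j * p j)
             / (1 - \sum_(1 <= j < i.+1) p j)) ^+ 2 =
  \sum_(1 <= j < N.+2) h j ^+ 2 * p j
  - (\sum_(1 <= j < N.+2) h j * p j) ^+ 2.
Proof.
move=> p0 p1.
pose S i : R := \sum_(i.+1 <= j < N.+2) p j.
pose T i : R := \sum_(i.+1 <= j < N.+2) h j * p j.
pose W i : R := \sum_(i.+1 <= j < N.+2) h j ^+ 2 * p j.
(* - V i is the second central moment of h on the outcomes after i, weighted by
   their mass S i; if S i = 0 then T i = 0 and the junk quotient is harmless. *)
pose V i := T i ^+ 2 / S i - W i.
have SE i : (i <= N.+1)%N -> 1 - \sum_(1 <= j < i.+1) p j = S i.
  move=> iN; rewrite -p1 (@big_cat_nat _ _ _ i.+1 1 N.+2)//=.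
  by rewrite addrC addrK.
rewrite (@eq_big_nat _ _ _ 1 N.+1 _ (fun i => V i - V i.-1)); last first.
  move=> [|i]// /andP[_ iN].
  rewrite !SE//=; [|by rewrite ltnW// ltnW|by rewrite ltnW].
  rewrite -/(T i.+1).
  have S0 : 0 <= S i.+1 by apply: sumr_ge0.
  have W1 k : (k <= N)%N -> (S k = p k.+1 + S k.+1) *
      (T k = h k.+1 * p k.+1 + T k.+1) *
      (W k = h k.+1 ^+ 2 * p k.+1 + W k.+1).
    by move=> kN; rewrite /S /T /W; do !split; rewrite big_ltn.
  have T0 : S i.+1 = 0 -> T i.+1 = 0.
    move=> /eqP; rewrite psumr_eq0// => /allP z.
    rewrite /T big_seq big1// => j /z /eqP ->; rewrite mulr0//.
  have iN' : (i <= N)%N by exact: ltnW.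
  rewrite /V; have [[-> ->] ->] := W1 i iN'.
  have [s0|s0] := eqVneq (S i.+1) 0.
    rewrite T0// s0 !(invr0, mulr0, mul0r, expr0n, addr0, sub0r, subr0)/=.
    have [->|q0] := eqVneq (p i.+1) 0; first by rewrite !(mulr0, mul0r); ring.
    by field.
  have q0 := p0 i.+1.
  have s1 : p i.+1 + S i.+1 != 0.
    by rewrite gt_eqF// ltr_wpDl// lt_neqAle eq_sym s0.
  by field; rewrite s0 s1.
rewrite big_add1/= telescope_sumr//.
(* Only the outcome [N.+1] is left after [N], and a single point has no variance. *)
have -> : V N = 0.
  rewrite /V /T /W /S !big_nat1.
  have [->|q0] := eqVneq (p N.+1) 0; first by rewrite !mulr0 expr0n mul0r subrr.
  by field.
by rewrite sub0r opprB /V /W /S /T /= p1 divr1.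
Qed.

(** Supplies the Chernoff parameter: [l ^+ 2 * V - l * t] will be the exponent for the threshold
    [t], and [l * D <= 1 / 3] is the range of [expR_le_quadratic]. *)
Lemma bernstein_exponent (R : rcfType) (L V D : R) : 0 < L -> 0 < D -> 0 <= V ->
  exists l : R, [/\ 0 <= l, l * D <= 1 / 3 &
    L <= l * (2 * Num.sqrt (L * V) + 3 * D * L) - l ^+ 2 * V].
Proof.
(* The optimal l = sqrt (L / V), capped at 1 / (3 D). *)
move=> L0 D0 V0.
rewrite sqrtrM; last exact: ltW.
set a := Num.sqrt L; set v := Num.sqrt V.
have a0 : 0 < a by rewrite sqrtr_gt0.
have v0 : 0 <= v by rewrite sqrtr_ge0.
have LE : L = a ^+ 2 by rewrite sqr_sqrtr// ltW.
have VE : V = v ^+ 2 by rewrite sqr_sqrtr.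
rewrite LE VE.
(* The condition says that [a / v] respects the cap; the square-root term of the threshold then
   yields [L] by itself. *)
have [av|av] := leP (3 * D * a) v.
  have vp : 0 < v by apply: lt_le_trans av; rewrite !mulr_gt0.
  exists (a / v); split; first by rewrite divr_ge0// ltW.
    by rewrite mulrAC ler_pdivrMr//; lra.
  have -> : a / v * (2 * (a * v) + 3 * D * a ^+ 2) - (a / v) ^+ 2 * v ^+ 2 =
            a ^+ 2 + a / v * (3 * D * a ^+ 2).
    by field; rewrite gt_eqF.
  by rewrite lerDl !mulr_ge0 ?invr_ge0 ?exprn_ge0// ltW.
(* At the cap the term [3 * D * L] yields [L], and what remains is nonnegative because
   [v / (3 * D) < a]. *)
exists ((3 * D)^-1); split.
- by rewrite invr_ge0 mulr_ge0// ltW.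
- have -> : (3 * D)^-1 * D = 1 / 3 by field; rewrite gt_eqF.
  by [].
have -> : (3 * D)^-1 * (2 * (a * v) + 3 * D * a ^+ 2) - (3 * D)^-1 ^+ 2 * v ^+ 2
    = a ^+ 2 + v / (3 * D) * (2 * a - v / (3 * D)).
  by field; rewrite gt_eqF.
have D3 : 0 < 3 * D by rewrite mulr_gt0.
rewrite lerDl mulr_ge0 ?divr_ge0 ?(ltW D3)//.
suff : v / (3 * D) < a by lra.
by rewrite ltr_pdivrMr// mulrC.
Qed.

(** Chernoff's method for the product law of [q]: the tail indicator is dominated by an exponential,
    whose mean factorises over the rounds. *)
Lemma bernstein (R : realType) (A : finType) (q g : A -> R) (n : nat)
    (D L mu V : R) :
  (forall a, 0 <= q a) -> \sum_a q a = 1 ->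
  (forall a b, `|g a - g b| <= D) -> 0 < L ->
  mu = \sum_a g a * q a -> V = \sum_a g a ^+ 2 * q a - mu ^+ 2 ->
  \sum_(c : {ffun 'I_n -> A} |
        2 * Num.sqrt (L * (V *+ n)) + 3 * D * L < \sum_i (mu - g (c i)))
     \prod_i q (c i) <= expR (- L).
Proof.
move=> q0 q1 gD L0 muE VE.
set t := 2 * Num.sqrt (L * (V *+ n)) + 3 * D * L.
(* The mean is a convex combination of values of [g], each within [D] of [g a]. *)
have muD a : mu - g a <= D.
  have -> : mu - g a = \sum_b (g b - g a) * q b.
    under [RHS]eq_bigr do rewrite mulrBl.
    by rewrite sumrB -mulr_sumr q1 mulr1 muE.
  rewrite -[leRHS]mulr1 -q1 mulr_sumr ler_sum// => b _.
  by rewrite ler_wpM2r// (le_trans (ler_norm _)).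
have mean0 : \sum_a q a * (mu - g a) = 0.
  under eq_bigr do rewrite mulrBr.
  rewrite sumrB -mulr_suml q1 mul1r muE.
  by under [X in _ - X]eq_bigr do rewrite mulrC; rewrite subrr.
have qV : \sum_a q a * (mu - g a) ^+ 2 = V.
  transitivity (\sum_a (mu ^+ 2 * q a - 2 * mu * (g a * q a) + g a ^+ 2 * q a)).
    by apply: eq_bigr => a _; ring.
  by rewrite big_split/= sumrB -!mulr_sumr q1 -muE VE; ring.
have V0 : 0 <= V.
  by rewrite -qV sumr_ge0// => a _; rewrite mulr_ge0// sqr_ge0.
have [a _|A0] := pickP (fun _ : A => true); last first.
  by move: q1; rewrite big_pred0// => /eqP; rewrite eq_sym oner_eq0.
have D0 : 0 <= D by apply: le_trans (gD a a).
have t0 : 0 <= t.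
  by rewrite addr_ge0// mulr_ge0 ?sqrtr_ge0// ?mulr_ge0// ltW.
(* If [D = 0] then no deviation is positive while [t >= 0], so the tail is empty; the exponent
   requires [D > 0]. *)
move: D0; rewrite le_eqVlt => /predU1P[D0|D0].
  rewrite big1 ?expR_ge0// => c; rewrite ltNge => /negP[].
  apply: le_trans t0; rewrite -oppr_ge0 -sumrN sumr_ge0// => i _.
  by rewrite oppr_ge0 D0.
have [l [l0 lD lL]] := bernstein_exponent L0 D0 (mulrn_wge0 n V0).
apply: (@le_trans _ _
    (expR (- (l * t)) * \sum_(c : {ffun 'I_n -> A})
       \prod_i (q (c i) * expR (l * (mu - g (c i)))))).
  (* Markov's step: the exponential factor is at least 1 on the tail and nonnegative elsewhere. *)
  rewrite mulr_sumr big_mkcond/=; apply: ler_sum => c _.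
  rewrite [X in _ <= _ * X]big_split/= mulrCA -expR_sum -expRD -mulr_sumr -mulrN -mulrDr.
  have pq : 0 <= \prod_i q (c i) by rewrite prodr_ge0.
  case: ifP => [tc|_]; last by rewrite mulr_ge0// expR_ge0.
  rewrite -[leLHS]mulr1 ler_wpM2l// -[leLHS]expR0 ler_expR mulr_ge0//.
  by rewrite addrC subr_ge0 ltW.
(* The sum over strings of a product is the product of [n] equal single-round sums. *)
rewrite -(bigA_distr_bigA (fun _ a => q a * expR (l * (mu - g a)))).
rewrite prodr_const card_ord.
(* In the quadratic bound the linear term averages to zero, leaving [1 + l ^+ 2 * V]. *)
have mgf : \sum_b q b * expR (l * (mu - g b)) <= expR (l ^+ 2 * V).
  apply: le_trans (expR_ge1Dx _).
  apply: (@le_trans _ _ (\sum_b (q b + l * (q b * (mu - g b))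
      + l ^+ 2 * (q b * (mu - g b) ^+ 2)))).
    apply: ler_sum => b _.
    have := @expR_le_quadratic _ (l * (mu - g b)) (le_trans (ler_wpM2l l0 (muD b)) lD).
    move=> /(ler_wpM2l (q0 b)) /le_trans; apply.
    by rewrite le_eqVlt; apply/orP; left; apply/eqP; ring.
  by rewrite !big_split/= -!mulr_sumr q1 mean0 qV mulr0 addr0.
apply: (@le_trans _ _ (expR (- (l * t)) * expR (l ^+ 2 * V) ^+ n)).
  rewrite ler_wpM2l ?expR_ge0// lerXn2r ?nnegrE ?expR_ge0//.
  by rewrite sumr_ge0// => b _; rewrite mulr_ge0// expR_ge0.
rewrite -expRM_natl -expRD ler_expR.
rewrite lerNr; apply: le_trans lL _.
by rewrite -mulr_natl le_eqVlt; apply/orP; left; apply/eqP; rewrite /t; ring.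
Qed.

(** * Finitely valued random variables *)

(** Preimages of points suffice for a finite codomain and spare it a sigma-algebra; fields of [run]
    such as [measurable_round] have this form. *)
Definition discretely_measurable (d : measure_display) (T : measurableType d)
    (F : finType) (f : T -> F) :=
  forall y, measurable (f @^-1` [set y])%classic.

Lemma discretely_measurable_comp d (T : measurableType d) (F G : finType)
    (g : F -> G) (f : T -> F) :
  discretely_measurable f -> discretely_measurable (g \o f).
Proof.
move=> mf y.
have -> : ((g \o f) @^-1` [set y] =
    \bigcup_(x in [set x | g x = y]) (f @^-1` [set x]))%classic.
  by apply/seteqP; split=> [w gy|w [x /= <- /= ->]]//; exists (f w).
by apply: fin_bigcup_measurable => [|x _]; [exact: finite_finset|exact: mf].
Qed.

Lemma discretely_measurable_ffun d (T : measurableType d) (I F : finType)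
    (f : I -> T -> F) :
  (forall k, discretely_measurable (f k)) ->
  discretely_measurable (fun w => [ffun k => f k w]).
Proof.
move=> mf y.
have -> : ((fun w => [ffun k => f k w]) @^-1` [set y] =
    \bigcap_(k in [set: I]) (f k @^-1` [set y k]))%classic.
  apply/seteqP; split=> [w /= <- k _ /=|w /= wy]; first by rewrite ffunE.
  by apply/ffunP => k; rewrite ffunE wy.
by apply: fin_bigcap_measurable => [|k _]; [exact: finite_finset|exact: mf].
Qed.

Lemma discretely_measurable_pair d (T : measurableType d) (F G : finType)
    (f : T -> F) (g : T -> G) :
  discretely_measurable f -> discretely_measurable g ->
  discretely_measurable (fun w => (f w, g w)).
Proof.
move=> mf mg [y z].
have -> : ((fun w => (f w, g w)) @^-1` [set (y, z)] =
    (f @^-1` [set y]) `&` (g @^-1` [set z]))%classic.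
  by apply/seteqP; split=> w /= [-> ->].
exact: measurableI.
Qed.

(** The choice depends only on the finite vector of membership bits, each of which is measurable. *)
Lemma discretely_measurable_pick d (T : measurableType d) (J : finType)
    (A : J -> set T) :
  (forall j, measurable (A j)) ->
  discretely_measurable (fun w => [pick j | `[< A j w >]]).
Proof.
move=> mA.
have -> : (fun w => [pick j | `[< A j w >]]) =
    (fun b : {ffun J -> bool} => [pick j | b j]) \o
    (fun w => [ffun j => `[< A j w >]]).
  by apply/funext => w /=; apply: eq_pick => j; rewrite ffunE.
apply: discretely_measurable_comp.
apply: (discretely_measurable_ffun (f := fun j w => `[< A j w >])).
move=> j [].
- rewrite [X in measurable X](_ : _ = A j)//.
  by apply/seteqP; split=> w /=; [move/asboolP | move=> ?; exact/asboolP].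
- rewrite [X in measurable X](_ : _ = ~` A j)%classic; last first.
    by apply/seteqP; split=> w /=; [move/asboolP | move=> ?; exact/asboolPn].
  exact: measurableC.
Qed.

Lemma prob_discretely_measurable d (T : measurableType d) (R : realType)
    (P : probability T R) (F : finType) (f : T -> F) (B : pred F) :
  discretely_measurable f ->
  (P [set w | B (f w)]%classic = \sum_(y | B y) P (f @^-1` [set y])%classic)%E.
Proof.
move=> mf.
have -> : ([set w | B (f w)] =
    \bigcup_(y in [set y | B y]) (f @^-1` [set y]))%classic.
  by apply/seteqP; split=> [w Bw|w [y By /= ->]]//; exists (f w).
rewrite measure_fin_bigcup//; last 2 first.
- exact: finite_finset.
- exact: trivIset_preimage1.
rewrite (fsbigE [seq y <- index_enum F | B y]).
- by rewrite big_filter_cond; apply: eq_bigl => y; apply: andb_idr => /mem_set.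
- by rewrite filter_uniq// index_enum_uniq.
- by move=> y /=; rewrite mem_filter => /andP[].
- by move=> y /= By; rewrite mem_filter By mem_index_enum.
Qed.

Lemma prob_setI_ge d (T : measurableType d) (R : realType)
    (P : probability T R) (A B : set T) (a b : R) :
  measurable A -> measurable B ->
  (1 - P A <= a%:E)%E -> (1 - P B <= b%:E)%E ->
  (1 - P (A `&` B)%classic <= (a + b)%:E)%E.
Proof.
move=> mA mB Aa Bb.
rewrite -probability_setC; last exact: measurableI.
rewrite setCI EFinD.
apply: (@le_trans _ _ (P (~` A)%classic + P (~` B)%classic)%E).
  by apply: measureU2; exact: measurableC.
by rewrite !probability_setC// leeD.
Qed.

Lemma big_option (R : Type) (idx : R) (op : Monoid.com_law idx) (B : finType)
    (F : option B -> R) :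
  \big[op/idx]_a F a = op (F None) (\big[op/idx]_b F (Some b)).
Proof.
rewrite (bigD1 None)//=; congr (op _ _).
rewrite (reindex_omap (@Some B) id)/=; last by case.
by apply: eq_bigl => b; rewrite eqxx.
Qed.

(** * Geometry of Bob's discretisation regions *)

Lemma measurable_PE_region (R : realType) (Q : protocol R) z :
  measurable (PE_region Q z).
Proof.
pose I1 : set R := (if (z %/ 4 < levels Q)%N
  then `[delta Q * (z %/ 4)%:R, delta Q * (z %/ 4).+1%:R[
  else `[Delta Q, +oo[)%classic.
pose I2 : set R :=
  (`[pi / 4 * (2 * (z %% 4)%:R - 1), pi / 4 * (2 * (z %% 4)%:R + 1)[)%classic.
have -> : PE_region Q z = (I1 `*` I2)%classic.
  rewrite /PE_region /I1 /I2 /in_quadrant.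
  apply/seteqP; split=> -[r t] /=; case: ifP => _;
    rewrite /= !in_itv/= ?andbT; by case.
apply: measurableX; rewrite /I1 /I2; last exact: measurable_itv.
by case: ifP => _; exact: measurable_itv.
Qed.

Lemma in_quadrant_inj (R : realType) (j k : nat) (t : R) :
  in_quadrant j t -> in_quadrant k t -> j = k.
Proof.
have pi4 : 0 < pi / 4 :> R by rewrite divr_gt0// pi_gt0.
have half (a b : nat) : in_quadrant a t -> in_quadrant b t -> (a <= b)%N.
  move=> /andP[ta _] /andP[_ tb].
  have := le_lt_trans ta tb.
  by rewrite ltr_pM2l// -ltnS -(ltr_nat R) -natr1; lra.
by move=> tj tk; apply/eqP; rewrite eqn_leq !half.
Qed.

Lemma DeltaE (R : realType) (Q : protocol R) :
  Delta Q = delta Q * (levels Q)%:R.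
Proof. by rewrite -levelsE mulrC divfK// gt_eqF// delta_gt0. Qed.

(** Writing [z = 4 k + j], the quadrant determines [j] and the ring determines [k]. *)
Lemma PE_region_inj (R : realType) (Q : protocol R) (z z' : 'I_(nbins Q)) u :
  PE_region Q z u -> PE_region Q z' u -> z = z'.
Proof.
move=> [qz rz] [qz' rz'].
have d0 := delta_gt0 Q.
(* Since [nbins] is [4 * (levels + 1)], an index outside the bounded rings has quotient exactly
   [levels]; its ring thus also starts at [delta] times the quotient. *)
have zle (y : 'I_(nbins Q)) : (y %/ 4 <= levels Q)%N.
  rewrite -ltnS ltn_divLR// (leq_trans (ltn_ord y))//.
  by rewrite [(_.+1 * 4)%N]mulnC mulnS.
have half (a b : 'I_(nbins Q)) : PE_region Q a u -> PE_region Q b u ->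
    (a %/ 4 <= b %/ 4)%N.
  move=> [_ ra] [_ rb].
  have {}ra : delta Q * (a %/ 4)%:R <= u.1.
    case: ifP ra => [_ /andP[]//|/negbT]; rewrite -leqNgt => la.
    have /eqP <- : levels Q == (a %/ 4)%N by rewrite eqn_leq la zle.
    by rewrite -DeltaE.
  move: rb; case: ifP => [_ /andP[_ rb]|/negbT]; last first.
    by rewrite -leqNgt => lb _; exact: leq_trans (zle a) lb.
  have := le_lt_trans ra rb.
  by rewrite ltr_pM2l// ltr_nat ltnS.
apply/val_inj; rewrite /= (divn_eq z 4) (divn_eq z' 4).
rewrite (in_quadrant_inj qz qz').
by congr (_ * 4 + _)%N; apply/eqP; rewrite eqn_leq !half.
Qed.

(** Reconciles the honest law, which integrates over [B] cut down to the polar domain, with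
    [p0_sim], which integrates over the whole region. *)
Lemma PE_region_sub_polar (R : realType) (Q : protocol R) z :
  (PE_region Q z `<=` @polar_domain R)%classic.
Proof.
move=> u [/andP[t1 t2] rz]; split.
  have d0 := delta_gt0 Q; have D0 := Delta_gt0 Q.
  case: ifP rz => _ => [/andP[+ _]|]; last exact/le_trans/ltW.
  by apply: le_trans; rewrite mulr_ge0// ltW.
have pi4 : 0 < pi / 4 :> R by rewrite divr_gt0// pi_gt0.
have z3 : (z %% 4)%:R <= 3 :> R by rewrite ler_nat -ltnS ltn_pmod.
have z0 : 0 <= (z %% 4)%:R :> R by [].
apply/andP; split.
- by apply: le_trans t1; nra.
- by apply: lt_le_trans t2 _; nra.
Qed.

(** * Classes of rounds and their honest law *)

(* The index i of the informal statement: [Some (x, z)] stands for i <= 4m, and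
   [None] for i = 4m + 1, to which all other statistics contribute. *)
Definition PE_class (R : realType) (Q : protocol R) (r : 'I_3) (x : 'I_4)
    (u : R * R) : option ('I_4 * 'I_(nbins Q)) :=
  if r == PE_round then
    omap (pair x) [pick z : 'I_(nbins Q) | `[< PE_region Q z u >]]
  else None.

Definition round_class (R : realType) (Q : protocol R) (n : nat)
    (d : measure_display) (Omega : measurableType d) (K : finType)
    (X : run R n Omega K) (i : 'I_n) (w : Omega) :=
  PE_class Q (round X i w) (symbol X i w) (Defs.radius X i w, phase X i w).

Definition class_law (R : realType) (Q : protocol R) (eta xi : R)
    (a : option ('I_4 * 'I_(nbins Q))) : R :=
  if a is Some xz then p0 eta xi xz.1 xz.2
  else 1 - \sum_(xz : 'I_4 * 'I_(nbins Q)) p0 eta xi xz.1 xz.2.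
Arguments class_law {R} Q eta xi a.

Definition class_weight (R : realType) (Q : protocol R)
    (h : 'I_4 -> 'I_(nbins Q) -> R) (a : option ('I_4 * 'I_(nbins Q))) : R :=
  if a is Some xz then h xz.1 xz.2 else 0.

(** Disjointness of the regions leaves [pick] at most one candidate. *)
Lemma PE_class_pick (R : realType) (Q : protocol R) z (u : R * R) :
  ([pick z : 'I_(nbins Q) | `[< PE_region Q z u >]] = Some z) <->
  PE_region Q z u.
Proof.
case: pickP => [y /asboolP uy|u0]; split=> //.
- by case=> <-.
- by move=> uz; congr Some; exact: PE_region_inj uy uz.
- by move=> /asboolP uz; rewrite u0 in uz.
Qed.

Lemma discretely_measurable_PE_class (R : realType) (Q : protocol R) r x :
  discretely_measurable (PE_class Q r x).
Proof.
apply: (discretely_measurable_comp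
  (fun b => if r == PE_round then omap (pair x) b else None)).
by apply: discretely_measurable_pick => z; exact: measurable_PE_region.
Qed.

Lemma measurable_polar_preimage (R : realType) n d (Omega : measurableType d)
    (K : finType) (X : run R n Omega K) i (B : set (R * R)) :
  measurable B ->
  measurable [set w | B (Defs.radius X i w, phase X i w)]%classic.
Proof.
move=> mB.
have mf : measurable_fun setT (fun w => (Defs.radius X i w, phase X i w)).
  by apply: measurable_fun_pair; [exact: measurable_radius|exact: measurable_phase].
by have := mf measurableT B mB; rewrite setTI.
Qed.

Lemma discretely_measurable_round_class (R : realType) (Q : protocol R) n d
    (Omega : measurableType d) (K : finType) (X : run R n Omega K) i :
  discretely_measurable (round_class Q X i).
Proof.
apply: (discretely_measurable_comp
  (fun b : 'I_3 * 'I_4 * option 'I_(nbins Q) =>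
    if b.1.1 == PE_round then omap (pair b.1.2) b.2 else None)
  (f := fun w => (round X i w, symbol X i w,
    [pick z : 'I_(nbins Q) |
      `[< PE_region Q z (Defs.radius X i w, phase X i w) >]]))).
apply: discretely_measurable_pair.
  apply: discretely_measurable_pair; first exact: measurable_round.
  exact: measurable_symbol.
apply: (discretely_measurable_pick
  (A := fun z : 'I_(nbins Q) => [set w |
     PE_region Q z (Defs.radius X i w, phase X i w)]%classic)) => z.
by apply: measurable_polar_preimage; exact: measurable_PE_region.
Qed.

Lemma discretely_measurable_raw_key (R : realType) n d
    (Omega : measurableType d) (K : finType) (X : run R n Omega K) :
  discretely_measurable (fun w => [tuple Z_key X i w | i < n]).
Proof.
have -> : (fun w => [tuple Z_key X i w | i < n]) =
    (fun b : {ffun 'I_n -> option 'I_4} => [tuple b i | i < n]) \o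
    (fun w => [ffun i => Z_key X i w]).
  by apply/funext => w; apply: eq_from_tnth => i; rewrite !tnth_mktuple ffunE.
apply: discretely_measurable_comp; apply: discretely_measurable_ffun => i.
apply: (discretely_measurable_comp
  (fun b : 'I_3 * option 'I_4 => if b.1 == key_round then b.2 else None)
  (f := fun w => (round X i w,
    [pick j : 'I_4 | `[< in_quadrant j (phase X i w) >]]))).
apply: discretely_measurable_pair; first exact: measurable_round.
apply: (discretely_measurable_pick
  (A := fun j : 'I_4 => [set w | in_quadrant j (phase X i w)]%classic)) => j.
pose I2 : set R := (`[pi / 4 * (2 * j%:R - 1), pi / 4 * (2 * j%:R + 1)[)%classic.
rewrite [X in measurable X](_ : _ = phase X i @^-1` I2)%classic; last first.
  by apply/seteqP; split=> w; rewrite /in_quadrant /I2 /= in_itv.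
rewrite -[X in measurable X]setTI.
by apply: (measurable_phase X i measurableT); exact: measurable_itv.
Qed.

(** The event is decided by the seed, Bob's raw key and the guess, all finitely valued. *)
Lemma measurable_Omega_EC (R : realType) n d (Omega : measurableType d)
    (K T : finType) (X : run R n Omega K) (hash : K -> raw_key n -> T) :
  measurable (Omega_EC X hash).
Proof.
pose f w := (seed X w, [tuple Z_key X i w | i < n] : raw_key n, guess X w).
have mf : discretely_measurable f.
  apply: discretely_measurable_pair; last exact: measurable_guess.
  apply: discretely_measurable_pair; first exact: measurable_seed.
  exact: discretely_measurable_raw_key.
pose g (b : K * raw_key n * raw_key n) := hash b.1.1 b.1.2 == hash b.1.1 b.2.
have -> : Omega_EC X hash = ((g \o f) @^-1` [set true])%classic.
  by apply/seteqP; split=> w /= /eqP.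
exact: discretely_measurable_comp.
Qed.

Lemma PE_round_neq_tom : PE_round != tom_round.
Proof. by rewrite -val_eqE /= !inordK. Qed.

(** The honest outcome law gives the classes [Some (x, z)]; [None] receives the complementary mass
    by normalisation. *)
Lemma prob_round_class (R : realType) (Q : protocol R) (eta xi : R) n d
    (Omega : measurableType d) (K : finType) (X : run R n Omega K)
    (P : probability Omega R) i a :
  honest Q X eta xi P ->
  P (round_class Q X i @^-1` [set a])%classic =
  (class_law Q eta xi a)%:E.
Proof.
move=> hX.
have some_law x z :
    P (round_class Q X i @^-1` [set Some (x, z)])%classic =
    (p0 eta xi x z)%:E.
  have eq_ev : (round_class Q X i @^-1` [set Some (x, z)] =
      [set w | [/\ round X i w = PE_round, symbol X i w = x &
        PE_region Q z (Defs.radius X i w, phase X i w)]])%classic.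
    apply/seteqP; split=> w /=; rewrite /round_class /PE_class.
      case: eqP => // ->.
      case E : [pick _ | _] => [y|]//= [<- yz]; split=> //.
      by apply/PE_class_pick; rewrite E yz.
    by move=> [-> -> /PE_class_pick ->]; rewrite eqxx.
  have mB := measurable_PE_region Q z.
  have pE : p_round Q PE_round = p_PE Q by rewrite /p_round /PE_round inordK.
  have Pev : P (round_class Q X i @^-1` [set Some (x, z)])%classic
      = ((p_PE Q)%:E * \int[leb2 (R:=R)]_(u in PE_region Q z)
          (heterodyne_density Q eta xi x u)%:E)%E.
    rewrite eq_ev; apply: etrans (honest_outcome hX i x PE_round_neq_tom mB) _.
    by rewrite pE (setIidl (PE_region_sub_polar (z:=z))).
  (* [p0_sim] is the real part of an extended integral, faithful only if that integral is finite.
     With [p_PE > 0], finiteness follows from that of the probability; with [p_PE = 0] both sides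
     vanish. *)
  have : P (round_class Q X i @^-1` [set Some (x, z)])%classic
      \is a fin_num.
    by apply: fin_num_measure; exact: discretely_measurable_round_class.
  rewrite Pev /p0 /p0_sim /Rintegral EFinM.
  have [->|p1] := eqVneq (p_PE Q) 0; first by rewrite !mul0e.
  have p0 : (0 < (p_PE Q)%:E)%E by rewrite lte_fin lt_neqAle eq_sym p1 p_PE_ge0.
  case: (integral _ _ _) => [r| |]//.
  - by rewrite gt0_muley.
  - by rewrite gt0_muleNy.
case: a => [[x z]|]; first exact: some_law.
have mc := discretely_measurable_round_class (Q := Q) X i.
have := prob_discretely_measurable P predT mc.
have -> : ([set w | predT (round_class Q X i w)] = setT)%classic.
  by apply/seteqP.
rewrite probability_setT big_option.
rewrite (eq_bigr (fun xz => (p0 eta xi xz.1 xz.2)%:E)); last first.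
  by move=> [x z] _; exact: some_law.
rewrite sumEFin /= => P1.
have /fineK PN : P (round_class Q X i @^-1` [set None])%classic
    \is a fin_num by apply: fin_num_measure; exact: mc.
move: P1; rewrite -PN -EFinD => -[P1].
by rewrite P1 addrK.
Qed.

(** Double counting: after exchanging the sums over pairs and rounds, each round matches at most one
    pair and contributes its weight. *)
Lemma freq_class_weight (R : realType) (Q : protocol R)
    (h : 'I_4 -> 'I_(nbins Q) -> R) n d (Omega : measurableType d) (K : finType)
    (X : run R n Omega K) w :
  f_PE h (freq (fun i => stat Q X i w)) =
  (\sum_i class_weight h (round_class Q X i w)) / n%:R.
Proof.
have statE i x z : (stat Q X i w == (Some x, Some z)) =
    (round_class Q X i w == Some (x, z)).
  rewrite /stat /X_PE /Z_PE /round_class /PE_class; case: ifP => // _.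
  (* If no region is found, the statistic is [(Some _, None)] and the class is [None], so neither
     side matches. *)
  case: pickP => [y _|_] /=; last by rewrite xpair_eqE andbF.
  by apply/eqP/eqP => -[-> ->].
rewrite /f_PE pair_big/= /freq.
under eq_bigr => xz _ do rewrite mulrA -sum1_card natr_sum mulr_sumr.
rewrite -mulr_suml; congr (_ / _).
rewrite (exchange_big_dep xpredT)//=; apply: eq_bigr => i _.
rewrite (eq_bigl (fun xz => round_class Q X i w == Some xz)).
  case: (round_class _ _ _ _) => [xz|]; last by rewrite big_pred0.
  by rewrite (big_pred1 xz) ?mulr1.
by move=> -[x z]; rewrite inE statE.
Qed.

(** * Lexicographic positions and moments of the score *)

(** The predecessor of a position is [x * nbins + z], from which Euclidean division recovers the
    pair. *)
Lemma sum_lex (R : realType) (Q : protocol R) (F : 'I_4 -> 'I_(nbins Q) -> R) :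
  \sum_(1 <= i < (4 * nbins Q).+1) lex F i = \sum_xz F xz.1 xz.2.
Proof.
rewrite big_add1/= big_nat_mul big_mkord -(pair_big xpredT xpredT F)/=.
apply: eq_bigr => x _.
rewrite -{1}[(x * _)%N]add0n big_addn mulSn addnK big_mkord.
apply: eq_bigr => z _; rewrite /lex/= addnC divnMDl// modnMDl.
by rewrite divn_small// modn_small// addn0 !inord_val.
Qed.

(** Lets [D_h], a maximum over positions, bound differences of class weights; [None] sits at
    position [4 m + 1]. *)
Lemma h_seq_class_weight (R : realType) (Q : protocol R)
    (h : 'I_4 -> 'I_(nbins Q) -> R) a :
  exists2 i, (1 <= i < (4 * nbins Q).+2)%N & h_seq h i = class_weight h a.
Proof.
case: a => [[x z]|]; last first.
  by exists (4 * nbins Q).+1; rewrite ?ltnS ?leqnn// /h_seq ltnn.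
have xz : (x * nbins Q + z < 4 * nbins Q)%N.
  rewrite (@leq_trans (x.+1 * nbins Q))//; last by rewrite leq_mul2r ltn_ord orbT.
  by rewrite mulSn addnC ltn_add2r.
exists (x * nbins Q + z).+1; first by rewrite !ltnS leqW// ltnW.
rewrite /h_seq xz /lex/= divnMDl// modnMDl divn_small// modn_small// addn0.
by rewrite !inord_val.
Qed.

Lemma class_weight_dist (R : realType) (Q : protocol R)
    (h : 'I_4 -> 'I_(nbins Q) -> R) a b :
  `|class_weight h a - class_weight h b| <= D_h h.
Proof.
have [i iN <-] := h_seq_class_weight h a.
have [j jN <-] := h_seq_class_weight h b.
apply: le_trans (@le_bigmax_seq _ _ _ _ 0 i xpredT _ _ _); last first.
- by [].
- by rewrite mem_index_iota.
by apply: (@le_bigmax_seq _ _ _ _ 0 j xpredT) => //; rewrite mem_index_iota.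
Qed.

(** As [k > 0], the last position and [None] both contribute zero. The cases [k = 1] and [k = 2]
    give the two moments in the variance. *)
Lemma sum_class_weight (R : realType) (Q : protocol R) (eta xi : R)
    (h : 'I_4 -> 'I_(nbins Q) -> R) (k : nat) : (0 < k)%N ->
  \sum_(1 <= i < (4 * nbins Q).+2) h_seq h i ^+ k * pi_seq Q eta xi i =
  \sum_a class_weight h a ^+ k * class_law Q eta xi a.
Proof.
move=> k0; rewrite big_nat_recr//= {2}/h_seq ltnn expr0n gtn_eqF// mul0r addr0.
rewrite big_option/= expr0n gtn_eqF// mul0r add0r.
rewrite -(sum_lex (fun x z => h x z ^+ k * p0 eta xi x z)).
by apply: eq_big_nat => i /andP[_ iN]; rewrite /h_seq /pi_seq -ltnS iN.
Qed.

Lemma sum_class_law (R : realType) (Q : protocol R) (eta xi : R) :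
  \sum_a class_law Q eta xi a = 1.
Proof. by rewrite big_option/= subrK. Qed.

Lemma sum_gamma_c_class (R : realType) (Q : protocol R) (eta xi : R)
    (h : 'I_4 -> 'I_(nbins Q) -> R) :
  (forall a, 0 <= class_law Q eta xi a) ->
  \sum_(1 <= i < (4 * nbins Q).+1)
     gamma_seq Q eta xi i * c_seq eta xi h i ^+ 2 =
  \sum_a class_weight h a ^+ 2 * class_law Q eta xi a
  - (\sum_a class_weight h a * class_law Q eta xi a) ^+ 2.
Proof.
move=> q0.
rewrite -sum_class_weight//.
under [X in _ = _ - X ^+ 2]eq_bigr do rewrite -[class_weight _ _]expr1.
rewrite -sum_class_weight//.
under [X in _ = _ - X ^+ 2]eq_bigr do rewrite expr1.
apply: sum_gamma_c_variance.
  move=> j; rewrite /pi_seq; case: ifP => _.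
    exact: (q0 (Some (_, _))).
  by rewrite sum_lex; exact: (q0 None).
rewrite big_nat_recr//= {2}/pi_seq ltnn.
have -> : \sum_(1 <= i < (4 * nbins Q).+1) pi_seq Q eta xi i =
    \sum_(1 <= i < (4 * nbins Q).+1) lex (@p0 R Q eta xi) i.
  by apply: eq_big_nat => i /andP[_ iN]; rewrite /pi_seq -ltnS iN.
by rewrite addrC subrK.
Qed.

(** * The tolerance as a Bernstein threshold *)

(** Passes from averages to sums: a factor [n ^ 2] under the root turns [V / n] into [n V], the
    variance of the total score. *)
Lemma n_delta_tol (R : realType) (Q : protocol R) (eta xi : R)
    (h : 'I_4 -> 'I_(nbins Q) -> R) (n : nat) (eps : R) : (0 < n)%N ->
  n%:R * delta_tol eta xi h n eps =
  2 * Num.sqrt (log2 (n%:R / eps) *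
    ((\sum_(1 <= i < (4 * nbins Q).+1)
        gamma_seq Q eta xi i * c_seq eta xi h i ^+ 2) *+ n))
  + 3 * D_h h * log2 (n%:R / eps).
Proof.
move=> n0; have nR : n%:R != 0 :> R by rewrite pnatr_eq0 -lt0n.
rewrite /delta_tol -mulr_suml; set V := \sum_(_ <= _ < _) _.
set L := log2 _.
have -> : L * (V *+ n) = n%:R ^+ 2 * (L * (V / n%:R)).
  by rewrite -mulr_natr; field.
rewrite [Num.sqrt (_ ^+ 2 * _)]sqrtrM ?sqr_ge0// sqrtr_sqr ger0_norm//.
by field.
Qed.

(** As [0 < ln 2 <= 1], passing to base 2 only enlarges the positive logarithm, so the exponential
    is at most [eps / n <= eps]. *)
Lemma expR_log2_le (R : realType) (n : nat) (eps : R) : (0 < n)%N ->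
  0 < eps < 1 -> 0 < log2 (n%:R / eps) /\ expR (- log2 (n%:R / eps)) <= eps.
Proof.
move=> n0 /andP[e0 e1].
have n1 : 1 <= n%:R :> R by rewrite ler1n.
have ne1 : 1 < n%:R / eps by rewrite ltr_pdivlMr// mul1r (lt_le_trans e1).
have l0 : 0 < ln (n%:R / eps) by rewrite ln_gt0.
have l2 : 0 < ln (2 : R) by rewrite ln_gt0// ltr1n.
have l21 : ln (2 : R) <= 1.
  by have := @le_ln1Dx R 1; rewrite -natr1 addrC; apply; lra.
split; first by rewrite divr_gt0.
apply: (@le_trans _ _ (expR (- ln (n%:R / eps)))).
  rewrite ler_expR lerN2 /log2 ler_pdivlMr//.
  by rewrite -[leRHS]mulr1 ler_wpM2l// ltW.
rewrite expRN lnK ?posrE ?divr_gt0// ?ltr0n// invf_div ler_pdivrMr ?ltr0n//.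
by rewrite -[leLHS]mulr1 ler_wpM2l// ltW.
Qed.

(** * Law of a whole run and completeness *)

(** Prescribing all classes is a conjunction of one event per round, to which the product rule
    applies. *)
Lemma prob_round_classes (R : realType) (Q : protocol R) (eta xi : R) n d
    (Omega : measurableType d) (K : finType) (X : run R n Omega K)
    (P : probability Omega R) (c : {ffun 'I_n -> option ('I_4 * 'I_(nbins Q))}) :
  honest Q X eta xi P ->
  P ((fun w => [ffun i => round_class Q X i w])
       @^-1` [set c])%classic =
  (\prod_i class_law Q eta xi (c i))%:E.
Proof.
move=> hX.
pose E i r x : set (R * R) := (PE_class Q r x @^-1` [set c i])%classic.
have mE i r x : measurable (E i r x) by exact: discretely_measurable_PE_class.
rewrite [X in P X](_ : _ = [set w | forall i, round_event X i (E i) w])%classic;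
  last first.
  apply/seteqP; split=> w /= wc.
    by move=> i; rewrite /round_event /E /= -wc ffunE.
  by apply/ffunP => i; rewrite ffunE; exact: wc.
apply: etrans (honest_independent hX mE) _.
rewrite -prodEFin; apply: eq_bigr => i _.
exact: prob_round_class.
Qed.

Lemma Omega_PE_complete (R : realType) (Q : protocol R) (eta xi : R)
    (n : nat) (h : 'I_4 -> 'I_(nbins Q) -> R) (eps : R) d
    (Omega : measurableType d) (P : probability Omega R) (K : finType)
    (X : run R n Omega K) :
  (0 < n)%N -> 0 < eps < 1 -> honest Q X eta xi P ->
  let O := Omega_PE X eta xi (delta_tol eta xi h n eps) h in
  measurable O /\ (1 - P O <= eps%:E)%E.
Proof.
move=> n0 eps01 hX O.
have [L0 Leps] := expR_log2_le n0 eps01.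
pose q := class_law Q eta xi; pose g := class_weight h.
pose F w : {ffun 'I_n -> option ('I_4 * 'I_(nbins Q))} :=
  [ffun i => round_class Q X i w].
(* Nonnegativity holds because [q] is the distribution of an actual round; [0 < n] provides round
   0. *)
have q0 a : 0 <= q a.
  by rewrite -lee_fin -(prob_round_class (Ordinal n0) a hX).
have mF : discretely_measurable F.
  apply: discretely_measurable_ffun => i.
  exact: discretely_measurable_round_class.
have muE : f_PE h (p0 eta xi) = \sum_a g a * q a.
  by rewrite /f_PE pair_big big_option/= mul0r add0r.
pose bad (c : {ffun 'I_n -> option ('I_4 * 'I_(nbins Q))}) :=
  n%:R * delta_tol eta xi h n eps < \sum_i (f_PE h (p0 eta xi) - g (c i)).
(* Multiplication by [n] turns a shortfall of the average score into a deviation of the sum. *)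
have badE : (~` O = [set w | bad (F w)])%classic.
  have iff w : O w <-> ~ bad (F w).
    have FE : \sum_i g (F w i) =
        \sum_i class_weight h (round_class Q X i w).
      by apply: eq_bigr => i _; rewrite ffunE.
    rewrite /O /Omega_PE /= freq_class_weight /bad sumrB sumr_const card_ord.
    rewrite FE ler_pdivlMr ?ltr0n//.
    rewrite -[f_PE _ _ *+ n]mulr_natr mulrBl [n%:R * _]mulrC.
    split; first by lra.
    by move/negP; rewrite -leNgt; lra.
  apply/seteqP; split=> w /= Hw; last by move=> /iff.
  by apply: contrapT => /iff.
have mO : measurable O.
  rewrite -(setCK O) badE; apply: measurableC.
  exact: (discretely_measurable_comp bad mF true).
split=> //; rewrite -probability_setC// badE.
rewrite (prob_discretely_measurable P bad mF).
rewrite (eq_bigr (fun c : {ffun 'I_n -> _} => (\prod_i q (c i))%:E)); last first.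
  by move=> c _; exact: prob_round_classes.
rewrite sumEFin lee_fin; apply: le_trans Leps; rewrite /bad.
have -> := n_delta_tol eta xi h eps n0.
rewrite (sum_gamma_c_class h q0).
apply: bernstein => //; first exact: sum_class_law.
- exact: class_weight_dist.
- by rewrite muE.
Qed.

Theorem theorem2 (R : realType) (Q : protocol R) (eta xi : R)
    (n : nat) (n_gt0 : (0 < n)%N)
    (h : 'I_4 -> 'I_(nbins Q) -> R)
    (eps_PE eps_EC : R)
    (eps_PE01 : 0 < eps_PE < 1) (eps_EC01 : 0 < eps_EC < 1)
    (d : measure_display) (Omega : measurableType d) (P : probability Omega R)
    (K T : finType) (hash : K -> raw_key n -> T)
    (X : run R n Omega K)
    (X_honest : honest Q X eta xi P)
    (EC_complete : (1 - P (Omega_EC X hash) <= eps_EC%:E)%E) :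
  complete P
    (Omega_NA X eta xi (delta_tol eta xi h n eps_PE) h hash)
    (eps_PE + eps_EC).
Proof.
have [mPE PE_complete] := Omega_PE_complete h n_gt0 eps_PE01 X_honest.
by apply: prob_setI_ge => //; exact: measurable_Omega_EC.
Qed.
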